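(* Consider a frustration-free quantum spin model on a finite interval $\Lambda\subseteq\mathbb{Z}$ with the ring geometry (see context), and suppose $H^{\mathrm{per}}_\Lambda$ is frustration-free on an invariant subspace $\mathcal{V}_\Lambda\subseteq\mathcal{H}_\Lambda$, i.e. $H^{\mathrm{per}}_\Lambda\mathcal{V}_\Lambda\subseteq\mathcal{V}_\Lambda$ and $\mathcal{V}_\Lambda\cap\ker(H^{\mathrm{per}}_\Lambda)\ne\{0\}$. Suppose $\Lambda=\bigcup_{i=1}^NX_i$ where the $X_i$ are subintervals (of the ring) which satisfy the following for all $1\le i,j\le N$ and some $1<n\le\lfloor N/2\rfloor$: (i) $\mathcal{V}_\Lambda$ is invariant under each $H_{X_i}$ and under each $H_{\Lambda_{n,k}}$, $1\le k\le N$, where $\Lambda_{n,k}=\bigcup_{i=k}^{n+k-1}X_i$ (indices modulo $N$); (ii) if $i<j$ and $X_i\cap X_j\ne\emptyset$, then $j=i+1$, or $j=N$ and $i=1$; (iii) every interaction term of $H^{\mathrm{per}}_\Lambda$ is supported on at least one $X_i$. Let $\gamma=\inf_{1\le i\le N}\mathrm{gap}(H_{X_i}\restriction_{\mathcal{V}_\Lambda})$ and $C=\sup_{1\le i\le N}\|H_{X_i}\|_{\mathcal{V}_\Lambda}$ (with $C>0$). Then $$\mathrm{gap}(H^{\mathrm{per}}_\Lambda\restriction_{\mathcal{V}_\Lambda})\ \ge\ \frac{\gamma n}{2C(n-1)}\left(\min_{1\le k\le N}\mathrm{gap}(H_{\Lambda_{n,k}}\restriction_{\mathcal{V}_\Lambda})-\frac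 Cn\right).$$
   Context: Setting: $\mathcal{H}_\Lambda=\bigotimes_{x\in\Lambda}\mathbb{C}^{n_x}$ is the finite-dimensional Hilbert space of a quantum spin model on $\Lambda$. The Hamiltonian $H^{\mathrm{per}}_\Lambda$ is a finite sum of interaction terms $h_Y$, each a self-adjoint operator acting non-trivially only on the sites $Y\subseteq\Lambda$ ($Y$ is its support; $\Lambda$ is viewed as a ring, so supports may wrap around), each shifted by its ground state energy so that $h_Y\ge0$. For a subinterval $X$ of the ring, $H_X$ (open boundary conditions) is the sum of those interaction terms whose support is contained in $X$, regarded as an operator on $\mathcal{H}_\Lambda$ by tensoring with the identity on $\Lambda\setminus X$. The model is frustration-free: every local Hamiltonian has nontrivial kernel, so that ground states are exactly the common zero-energy states of all its interaction terms. For a subspace $\mathcal{V}\subseteq\mathcal{H}_\Lambda$ and an operator $A$: $\|A\|_{\mathcal{V}}=\sup_{0\ne\psi\in\mathcal{V}}\|A\psi\|/\|\psi\|$ (and $0$ if $\mathcal{V}=\{0\}$). If $A\ge0$, $A\mathcal{V}\subseteq\mathcal{V}$ and $\ker(A\restriction_{\mathcal{V}})\neq\{0\}$, then $\mathrm{gap}(A\restriction_{\mathcal{V}})$ is the smallest positive eigenvalue of $A\restriction_{\mathcal{V}}$, with the convention $\mathrm{gap}(A\restriction_{\mathcal{V}})=\infty$ if $\mathcal{V}\subseteq\ker A$. *)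

(* Defs.v *)
From mathcomp Require Import all_boot all_order all_algebra.
From mathcomp Require Import complex.
From mathcomp Require Import all_classical all_reals ereal.

Set Implicit Arguments.
Unset Strict Implicit.
Unset Printing Implicit Defensive.

Import Order.TTheory GRing.Theory Num.Theory.

Local Open Scope ring_scope.
Local Open Scope complex_scope.

(* The tensor product over x in S of the spaces C^(d x) is realised as the    *)
(* space of functions on its product basis, which is indexed by the           *)
(* configurations s with s x < d x.                                           *)
Definition config (S : finType) (d : S -> nat) : finType :=
  {dffun forall x : S, 'I_(d x)}.

Definition hilb (R : realType) (S : finType) (d : S -> nat) : vectType R[i] :=
  {ffun config d -> R[i]^o}.

Definition inner (R : realType) (S : finType) (d : S -> nat)
    (phi psi : hilb R d) : R[i] :=
  \sum_(s : config d) conjc (phi s) * psi s.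

Definition hnorm (R : realType) (S : finType) (d : S -> nat)
    (psi : hilb R d) : R :=
  Num.sqrt (complex.Re (inner psi psi)).

Definition self_adjoint (R : realType) (S : finType) (d : S -> nat)
    (A : 'End(hilb R d)) : Prop :=
  forall phi psi : hilb R d, inner phi (A psi) = inner (A phi) psi.

(* The order of R[i] makes [0 <= z] include that z is real. *)
Definition psd (R : realType) (S : finType) (d : S -> nat)
    (A : 'End(hilb R d)) : Prop :=
  forall psi : hilb R d, 0 <= inner psi (A psi).

Definition restrict_config (S : finType) (d : S -> nat) (Y : {set S})
    (s : config d) : config (fun x : {x : S | x \in Y} => d (val x)) :=
  [ffun x : {x : S | x \in Y} => s (val x)].

(* A = B (x) 1, where the kernel B is the matrix, in the product basis, of an *)
(* operator on the tensor product over the sites of Y.                        *)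
Definition acts_on (R : realType) (S : finType) (d : S -> nat) (Y : {set S})
    (A : 'End(hilb R d)) : Prop :=
  exists B : config (fun x : {x : S | x \in Y} => d (val x)) ->
             config (fun x : {x : S | x \in Y} => d (val x)) -> R[i],
  forall (psi : hilb R d) (s : config d),
    A psi s = \sum_(t : config d | [forall x, (x \notin Y) ==> (t x == s x)])
                B (restrict_config Y s) (restrict_config Y t) * psi t.

(* The sites are numbered 0, ..., L - 1 and [ordS] is the cyclic successor;   *)
(* a support may be any set of sites, in particular it may wrap around.       *)
(* [term_ker] says that 0 is the ground state energy of each term.            *)
Record spin_model (R : realType) (L : nat) (d : 'I_L -> nat) := SpinModel {
  term : finType;
  supp : term -> {set 'I_L};
  interaction : term -> 'End(hilb R d);
  term_self_adjoint : forall t, self_adjoint (interaction t);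
  term_acts_on : forall t, acts_on (supp t) (interaction t);
  term_psd : forall t, psd (interaction t);
  term_ker : forall t, lker (interaction t) != 0%VS }.

Definition ham_per (R : realType) (L : nat) (d : 'I_L -> nat)
    (M : spin_model R d) : 'End(hilb R d) :=
  \sum_(t : term M) interaction t.

Definition ham (R : realType) (L : nat) (d : 'I_L -> nat)
    (M : spin_model R d) (X : {set 'I_L}) : 'End(hilb R d) :=
  \sum_(t : term M | supp t \subset X) interaction t.

Definition ring_interval (L : nat) (X : {set 'I_L}) : Prop :=
  exists (a : 'I_L) (l : nat), X = [set iter m (@ordS L) a | m : 'I_l]%SET.

Definition frustration_free (R : realType) (L : nat) (d : 'I_L -> nat)
    (M : spin_model R d) : Prop :=
  forall X : {set 'I_L}, ring_interval X -> lker (ham M X) != 0%VS.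

(* The union of the n cyclically consecutive sets X_k, ..., X_(k + n - 1). *)
Definition block (L N : nat) (X : 'I_N -> {set 'I_L}) (n : nat) (k : 'I_N)
    : {set 'I_L} :=
  (\bigcup_(m < n) X (iter m (@ordS N) k))%SET.

Definition invariant_subspace (R : realType) (S : finType) (d : S -> nat)
    (A : 'End(hilb R d)) (V : {vspace hilb R d}) : Prop :=
  (A @: V <= V)%VS.

(* The real supremum of the empty set is 0, as required for V = 0. *)
Definition opnorm (R : realType) (S : finType) (d : S -> nat)
    (A : 'End(hilb R d)) (V : {vspace hilb R d}) : R :=
  sup [set hnorm (A psi) / hnorm psi | psi in
        [set psi : hilb R d | psi \in V /\ psi != 0]]%classic.

(* The infimum is over the positive eigenvalues of A on V, a finite set. It   *)
(* is +oo if there are none; for A >= 0 leaving V invariant this means that V *)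
(* is contained in the kernel of A.                                           *)
Definition gap (R : realType) (S : finType) (d : S -> nat)
    (A : 'End(hilb R d)) (V : {vspace hilb R d}) : \bar R :=
  ereal_inf [set l%:E | l in
    [set l : R | 0 < l /\ (V :&: passmx.leigenspace A l%:C)%VS != 0%VS]]%classic.

(* Main.v *)
(* Knabe's argument.  In an orthonormal basis of V the Hamiltonians become      *)
(* positive semidefinite matrices; let P_i be the projection onto the range of *)
(* H_(X_i) on V, and A_k the sum of the P_i over the n indices i of block k.   *)
(* Then sum_k A_k^2 = sum_(i, j) w(i, j) P_i P_j, where w(i, j) counts the     *)
(* blocks containing both i and j: it is n if i = j, n - 1 for neighbours, and *)
(* at most n - 1 for the other pairs, whose P_i P_j >= 0 since they commute.   *)
(* So sum_k A_k^2 <= H + (n - 1) H^2 for H = sum_i P_i, while A_k^2 >= g A_k   *)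
(* for g = gap(A_k), and sum_k A_k = n H; hence gap(H) >= (n g - 1) / (n - 1). *)
(* This transfers to the spin model by H_(block k) <= C A_k and                *)
(* gamma H <= sum_i H_(X_i) <= 2 H^per: a nonempty support lies in at most two *)
(* of the X_i, and one contained in a block lies in an X_i of that block.      *)
From HB Require Import structures.
Require Import Defs.
From mathcomp Require Import all_boot all_order all_algebra.
From mathcomp Require Import complex.
From mathcomp Require Import all_classical all_reals ereal.
From mathcomp Require Import zify ring.

Set Implicit Arguments.
Unset Strict Implicit.
Unset Printing Implicit Defensive.

Import Order.TTheory GRing.Theory Num.Theory.

Local Open Scope ring_scope.
Local Open Scope sesquilinear_scope.

(** * Positive semidefinite matrices *)

(** Gaps are compared through eigenvectors. Let v be an eigenvector of a positive matrix A for an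
    eigenvalue l > 0. Then v is orthogonal to ker A, hence to ker D whenever ker D is contained in
    ker A, so gap(D) |v|^2 <= <v, D v> ([gap_ge_transfer]); a form bound D <= c A then gives gap(D)
    <= c l. This is used twice in [knabe_bound]: to pass from H_(block k) to the sum A_k of the
    range projections of that block, and from the sum of all P_i to H^per. In between, the operator
    inequality of [knabe_square], evaluated at an eigenvector of the sum of all P_i, becomes a
    scalar inequality for its eigenvalue.

    The inputs are of three kinds. [card_mem_arc], [card_mem_arc2_lt] and [card_mem_arc2_next] count
    the blocks through one or two indices. [sum_hform_le2], [hform_le_sum], [hform_block_le] and
    [hform_sub_block] compare quadratic forms by counting interaction terms, and [ham_comm] gives
    the commutation. Finally V is replaced by orthonormal coordinates ([subspace_coords]), in which
    [gap_coords] and [eig_le_opnorm] translate [gap] and [opnorm] into bounds on eigenvalues of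
    matrices. *)

Section QuadraticForm.
Context {C : numClosedFieldType} {m : nat}.
Implicit Types (A B : 'M[C]_m) (u v : 'rV[C]_m).

Definition qform A v : C := (v *m A *m v^t*) 0 0.

Definition sqnorm v : C := (v *m v^t*) 0 0.

Definition psdmx A := A^t* = A /\ forall v, 0 <= qform A v.

(** A lower bound instead of the gap itself: a matrix without positive eigenvalues, whose gap is
    infinite, then needs no special case. *)
Definition gap_ge A (g : C) :=
  forall l v, 0 < l -> v != 0 -> v *m A = l *: v -> g <= l.

Definition eig_le A (c : C) :=
  forall l v, 0 < l -> v != 0 -> v *m A = l *: v -> l <= c.

Lemma qform_sum (I : finType) (P : pred I) (F : I -> 'M[C]_m) v :
  qform (\sum_(i | P i) F i) v = \sum_(i | P i) qform (F i) v.
Proof. by rewrite /qform mulmx_sumr mulmx_suml summxE. Qed.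

Lemma qform_eigen A v l : v *m A = l *: v -> qform A v = l * sqnorm v.
Proof. by move=> vA; rewrite /qform vA -scalemxAl mxE. Qed.

Lemma qform_sq_eigen A v l :
  v *m A = l *: v -> qform (A *m A) v = l ^+ 2 * sqnorm v.
Proof.
move=> vA; rewrite /qform mulmxA vA -scalemxAl vA scalerA -scalemxAl.
by rewrite mxE expr2.
Qed.

Lemma sqnormE v : sqnorm v = \sum_i `|v 0 i| ^+ 2.
Proof.
by rewrite /sqnorm mxE; apply: eq_bigr => i _; rewrite !mxE normCK.
Qed.

Lemma sqnorm_gt0 v : v != 0 -> 0 < sqnorm v.
Proof. by move=> /dotmx_is_dotmx; rewrite dotmxE. Qed.

Lemma sqnorm_ge0 v : 0 <= sqnorm v.
Proof. by rewrite sqnormE sumr_ge0 // => i _; rewrite exprn_ge0. Qed.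

Lemma qform_hermsq A B v : qform (A *m B *m (A *m B)^t*) v = sqnorm (v *m A *m B).
Proof.
rewrite /qform /sqnorm -!mulmxA; congr (_ 0 0).
by rewrite [(v *m (A *m B))^T]trmx_mul map_mxM /= !mulmxA.
Qed.

(** * Spectral calculus of one positive semidefinite matrix *)

Section Spectral.
Variable A : 'M[C]_m.
Hypothesis A_psd : psdmx A.

Let U := spectralmx A.
Let d i := spectral_diag A 0 i.

Lemma spectral_decomp : A = U^t* *m diag_mx (spectral_diag A) *m U.
Proof.
have A_normal : A \is normalmx by apply/normalmxP; rewrite A_psd.1.
have /orthomx_spectralP := A_normal.
by rewrite invmx_unitary ?spectral_unitarymx.
Qed.

Lemma spectral_mulV : U *m U^t* = 1%:M.
Proof. exact/unitarymxP/spectral_unitarymx. Qed.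

Lemma spectral_Vmul : U^t* *m U = 1%:M.
Proof. exact/mulmx1C/spectral_mulV. Qed.

Lemma spectral_row i : row i U *m A = d i *: row i U.
Proof.
rewrite [in LHS]spectral_decomp !mulmxA -row_mul spectral_mulV.
by rewrite -row_mul mul1mx row_diag_mx -scalemxAl -rowE.
Qed.

Lemma spectral_row_neq0 i : row i U != 0.
Proof.
apply/eqP => Ui0; have := congr1 (fun M : 'M_m => row i M) spectral_mulV.
rewrite row_mul Ui0 mul0mx => /(congr1 (fun M : 'rV_m => M 0 i)).
by rewrite !mxE eqxx => /eqP; rewrite eq_sym oner_eq0.
Qed.

Lemma qform_diag (e : 'rV[C]_m) v :
  qform (U^t* *m diag_mx e *m U) v = \sum_i e 0 i * `|(v *m U^t*) 0 i| ^+ 2.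
Proof.
have vUC : (v *m U^t*)^t* = U *m v^t* by rewrite trmx_mul map_mxM /= trmxCK.
have -> : qform (U^t* *m diag_mx e *m U) v = qform (diag_mx e) (v *m U^t*).
  by rewrite /qform vUC !mulmxA.
rewrite /qform mxE; apply: eq_bigr => i _.
by rewrite mul_mx_diag [X in X * _]mxE normCK [(_^t*) i 0]mxE
           [(_^T) i 0]mxE mulrAC mulrC.
Qed.

Lemma spectral_sqnorm v : sqnorm v = \sum_i `|(v *m U^t*) 0 i| ^+ 2.
Proof.
by rewrite -sqnormE /sqnorm trmx_mul map_mxM /= trmxCK mulmxA
           -(mulmxA v) spectral_Vmul mulmx1.
Qed.

Lemma spectral_kerE v i : v *m row i U ^t* = ((v *m U^t*) 0 i)%:M.
Proof.
apply/rowP=> j; rewrite !mxE ord1 eqxx mulr1n.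
by apply: eq_bigr => k _; rewrite !mxE.
Qed.

Lemma spectral_qform v :
  qform A v = \sum_i d i * `|(v *m U^t*) 0 i| ^+ 2.
Proof. by rewrite [in LHS](spectral_decomp) qform_diag. Qed.

Lemma spectral_qform_sq v :
  qform (A *m A) v = \sum_i d i ^+ 2 * `|(v *m U^t*) 0 i| ^+ 2.
Proof.
have -> : A *m A = U^t* *m diag_mx (\row_i (d i ^+ 2)) *m U.
  have -> : diag_mx (\row_i (d i ^+ 2)) =
            diag_mx (spectral_diag A) *m diag_mx (spectral_diag A).
    by rewrite mulmx_diag; congr diag_mx; apply/rowP => i; rewrite !mxE expr2.
  by rewrite [in LHS]spectral_decomp !mulmxA -(mulmxA _ U) spectral_mulV mulmx1.
by rewrite qform_diag; apply: eq_bigr => i _; rewrite mxE.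
Qed.

Lemma spectral_diag_ge0 i : 0 <= d i.
Proof.
have := A_psd.2 (row i U); rewrite (qform_eigen (spectral_row i)).
by rewrite pmulr_lge0 // sqnorm_gt0 // spectral_row_neq0.
Qed.

Lemma spectral_gap_ge g i : gap_ge A g -> d i != 0 -> g <= d i.
Proof.
move=> gap_g di_neq0; apply: gap_g (spectral_row_neq0 i) (spectral_row i).
by rewrite lt_neqAle eq_sym di_neq0 spectral_diag_ge0.
Qed.

Lemma spectral_eig_le c i : 0 <= c -> eig_le A c -> d i <= c.
Proof.
move=> c_ge0 le_c; have [->//|di_neq0] := eqVneq (d i) 0.
apply: le_c (spectral_row_neq0 i) (spectral_row i).
by rewrite lt_neqAle eq_sym di_neq0 spectral_diag_ge0.
Qed.

Lemma spectral_coord_eq0 v i :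
  (forall u, u *m A = 0 -> v *m u^t* = 0) -> d i = 0 -> (v *m U^t*) 0 i = 0.
Proof.
move=> v_orth di0; have := v_orth (row i U); rewrite spectral_row di0 scale0r.
move=> /(_ erefl); rewrite spectral_kerE => /(congr1 (fun M : 'M_1 => M 0 0)).
by rewrite !mxE.
Qed.

(** In an eigenbasis the form is a sum of non-negative terms, so each of them vanishes. This turns
    inequalities between forms into inclusions of kernels. *)
Lemma psdmx_ker v : qform A v = 0 -> v *m A = 0.
Proof.
rewrite spectral_qform => /eqP; rewrite psumr_eq0; last first.
  by move=> i _; rewrite mulr_ge0 ?spectral_diag_ge0 ?exprn_ge0.
move=> /allP w0; rewrite spectral_decomp !mulmxA.
suff -> : v *m U^t* *m diag_mx (spectral_diag A) = 0 by rewrite mul0mx.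
apply/rowP => i; rewrite mul_mx_diag [LHS]mxE [RHS]mxE.
have := w0 i; rewrite mem_index_enum => /(_ isT) /=.
by rewrite mulf_eq0 expf_eq0 normr_eq0 /= mulrC => /orP[] /eqP; rewrite /d => ->;
  rewrite ?mul0r ?mulr0.
Qed.

(** The coordinates of [v] along zero eigenvalues vanish, and all other eigenvalues are at least
    [g]. *)
Lemma gap_ge_qform g v : gap_ge A g ->
  (forall u, u *m A = 0 -> v *m u^t* = 0) -> g * sqnorm v <= qform A v.
Proof.
move=> gap_g v_orth; rewrite spectral_sqnorm spectral_qform mulr_sumr.
apply: ler_sum => i _; have [di0|di_neq0] := eqVneq (d i) 0.
  by rewrite (spectral_coord_eq0 v_orth di0) normr0 expr0n !mulr0.
by rewrite ler_wpM2r ?exprn_ge0 // spectral_gap_ge.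
Qed.

Lemma gap_ge_qform_sq g v : gap_ge A g -> g * qform A v <= qform (A *m A) v.
Proof.
move=> gap_g; rewrite spectral_qform_sq spectral_qform mulr_sumr.
apply: ler_sum => i _; rewrite mulrA ler_wpM2r ?exprn_ge0 // expr2.
have [->|di_neq0] := eqVneq (d i) 0; first by rewrite !mulr0.
by rewrite ler_wpM2r ?spectral_diag_ge0 // spectral_gap_ge.
Qed.

(** The sum of the eigenvalues dominates each of them. This boundedness is what makes the supremum
    in [opnorm] an upper bound. *)
Lemma qform_sq_bound :
  exists2 D : C, 0 <= D & forall v, qform (A *m A) v <= D ^+ 2 * sqnorm v.
Proof.
have D_ge0 : 0 <= \sum_i d i by apply: sumr_ge0 => i _; apply: spectral_diag_ge0.
exists (\sum_i d i) => // v; rewrite spectral_qform_sq spectral_sqnorm mulr_sumr.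
apply: ler_sum => i _; rewrite ler_wpM2r ?exprn_ge0 //.
rewrite lerXn2r ?nnegrE ?spectral_diag_ge0 // (bigD1 i) //= lerDl.
by apply: sumr_ge0 => j _; apply: spectral_diag_ge0.
Qed.

Lemma psdmx_eigen : A != 0 ->
  exists l, exists v, [/\ 0 < l, v != 0 & v *m A = l *: v].
Proof.
move=> A_neq0; have [/existsP[i di]|] := boolP [exists i, d i != 0].
  exists (d i), (row i U); rewrite spectral_row_neq0 spectral_row; split=> //.
  by rewrite lt_neqAle eq_sym di spectral_diag_ge0.
rewrite negb_exists => /forallP d0; case/eqP: A_neq0.
have diag0 : spectral_diag A = 0.
  by apply/rowP => i; rewrite mxE; apply/eqP; have := d0 i; rewrite negbK.
by rewrite spectral_decomp diag0 linear0 mulmx0 mul0mx.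
Qed.

(** The orthogonal projection onto the range of [A]: every nonzero eigenvalue is replaced by 1. *)
Definition rangemx : 'M[C]_m :=
  U^t* *m diag_mx (\row_i (d i != 0)%:R) *m U.

Lemma rangemx_herm : rangemx^t* = rangemx.
Proof.
rewrite /rangemx !trmx_mul !map_mxM /= trmxCK mulmxA tr_diag_mx map_diag_mx.
congr (_ *m diag_mx _ *m _); apply/rowP => i; rewrite !mxE; exact: conjC_nat.
Qed.

Lemma rangemx_idem : rangemx *m rangemx = rangemx.
Proof.
rewrite /rangemx !mulmxA -(mulmxA _ U) spectral_mulV mulmx1 -(mulmxA (U^t*)).
rewrite mulmx_diag; congr (_ *m diag_mx _ *m _); apply/rowP => i.
by rewrite !mxE -natrM mulnb andbb.
Qed.

Lemma rangemx_psd : psdmx rangemx.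
Proof.
split=> [|v]; first exact: rangemx_herm.
rewrite qform_diag sumr_ge0 // => i _.
by rewrite mxE mulr_ge0 ?ler0n ?exprn_ge0.
Qed.

(** In an eigenbasis of [A], a matrix commuting with [A] has no entries between distinct
    eigenvalues, so it commutes with every function of [A]. *)
Lemma rangemx_comm B : A *m B = B *m A -> rangemx *m B = B *m rangemx.
Proof.
pose B' := U *m B *m U^t*.
have BE : B = U^t* *m B' *m U.
  by rewrite /B' !mulmxA spectral_Vmul mul1mx -mulmxA spectral_Vmul mulmx1.
move=> AB; have dB' : diag_mx (spectral_diag A) *m B' =
    B' *m diag_mx (spectral_diag A).
  have UA : U *m A = diag_mx (spectral_diag A) *m U.
    by rewrite [in LHS]spectral_decomp !mulmxA spectral_mulV mul1mx.
  have AU : A *m U^t* = U^t* *m diag_mx (spectral_diag A).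
    by rewrite [in LHS]spectral_decomp -!mulmxA spectral_mulV mulmx1.
  by rewrite /B' !mulmxA -UA -[RHS]mulmxA -AU !mulmxA -(mulmxA U A) AB !mulmxA.
clearbody B'; have eB' : diag_mx (\row_i (d i != 0)%:R) *m B' =
    B' *m diag_mx (\row_i (d i != 0)%:R).
  apply/matrixP => i j; have := congr1 (fun M : 'M_m => M i j) dB'.
  rewrite !mul_mx_diag !mul_diag_mx !mxE -/(d i) -/(d j).
  have [->|B'ij] := eqVneq (B' i j) 0; first by rewrite !(mul0r, mulr0).
  by rewrite mulrC => /(mulfI B'ij) ->; rewrite mulrC.
rewrite BE /rangemx !mulmxA -(mulmxA _ U) spectral_mulV mulmx1.
rewrite -(mulmxA (U^t*)) eB' !mulmxA.
by rewrite -[X in _ = X *m _ *m _]mulmxA spectral_mulV mulmx1.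
Qed.

Lemma rangemx_ker v : v *m A = 0 <-> v *m rangemx = 0.
Proof.
split=> vA; last first.
  suff -> : A = rangemx *m A by rewrite mulmxA vA mul0mx.
  rewrite [in LHS]spectral_decomp [in RHS]spectral_decomp /rangemx !mulmxA.
  rewrite -(mulmxA _ U) spectral_mulV mulmx1.
  rewrite -(mulmxA _ (diag_mx _) (diag_mx _)) mulmx_diag.
  congr (_ *m diag_mx _ *m _); apply/rowP => i; rewrite !mxE /d.
  by have [->|] := eqVneq (spectral_diag A 0 i) 0; rewrite ?mul0r ?mul1r.
(* The second factor is the pseudo-inverse of [A], as the inverse of 0 is 0. *)
have E : rangemx = A *m (U^t* *m diag_mx (\row_i (d i)^-1) *m U).
  rewrite [in RHS]spectral_decomp /rangemx !mulmxA.
  rewrite -(mulmxA _ U) spectral_mulV mulmx1.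
  rewrite -(mulmxA _ (diag_mx _) (diag_mx _)) mulmx_diag.
  congr (_ *m diag_mx _ *m _); apply/rowP => i; rewrite !mxE /d.
  by have [->|?] := eqVneq (spectral_diag A 0 i) 0; rewrite ?mul0r // divff.
by rewrite E mulmxA vA mul0mx.
Qed.

(** With [rangemx_eig_le], this sandwiches a Hamiltonian between multiples of its range projection,
    g P <= A <= c P. *)
Lemma rangemx_gap g v : gap_ge A g -> g * qform rangemx v <= qform A v.
Proof.
move=> gap_g; rewrite spectral_qform qform_diag mulr_sumr.
apply: ler_sum => i _; rewrite mulrA ler_wpM2r ?exprn_ge0 // mxE.
by have [->|?] := eqVneq (d i) 0; rewrite ?mulr0 // mulr1 spectral_gap_ge.
Qed.

Lemma rangemx_eig_le c v :
  0 <= c -> eig_le A c -> qform A v <= c * qform rangemx v.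
Proof.
move=> c_ge0 le_c; rewrite spectral_qform qform_diag mulr_sumr.
apply: ler_sum => i _; rewrite [leRHS]mulrA ler_wpM2r ?exprn_ge0 // mxE.
have [->|?] := eqVneq (d i) 0; first by rewrite mulr0.
by rewrite mulr1 spectral_eig_le.
Qed.

End Spectral.
End QuadraticForm.

(** A product of two commuting orthogonal projections equals its own product with its adjoint. *)
Lemma qform_comm_proj_ge0 (C : numClosedFieldType) m (P Q : 'M[C]_m) v :
  P^t* = P -> P *m P = P -> Q^t* = Q -> Q *m Q = Q -> P *m Q = Q *m P ->
  0 <= qform (P *m Q) v.
Proof.
move=> Ph Pi Qh Qi PQ.
suff -> : P *m Q = (P *m Q) *m (P *m Q)^t* by rewrite qform_hermsq sqnorm_ge0.
rewrite trmx_mul map_mxM /= Ph Qh mulmxA -[P *m Q *m Q]mulmxA Qi.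
by rewrite -[P *m Q *m P]mulmxA -PQ mulmxA Pi.
Qed.

Lemma psdmx_sum (C : numClosedFieldType) m (I : finType) (D : pred I)
    (F : I -> 'M[C]_m) :
  (forall i, psdmx (F i)) -> psdmx (\sum_(i | D i) F i).
Proof.
move=> F_psd; split=> [|v].
  by rewrite !raddf_sum /=; apply: eq_bigr => i _; rewrite (F_psd i).1.
by rewrite qform_sum sumr_ge0 // => i _; apply: (F_psd i).2.
Qed.

Lemma qform_sum_mul (C : numClosedFieldType) m (I : finType) (D : {pred I})
    (P : I -> 'M[C]_m) v :
  qform ((\sum_(i in D) P i) *m (\sum_(i in D) P i)) v =
  \sum_i \sum_j ((i \in D) && (j \in D))%:R * qform (P i *m P j) v.
Proof.
rewrite mulmx_suml qform_sum big_mkcond; apply: eq_bigr => i _.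
case: (i \in D) => /=; last by rewrite big1 // => j _; rewrite mul0r.
rewrite mulmx_sumr qform_sum big_mkcond; apply: eq_bigr => j _.
by case: (j \in D); rewrite ?mul1r ?mul0r.
Qed.

(** * Knabe's inequality for an abstract family of blocks *)

Section Knabe.
Context {C : numClosedFieldType} {m : nat} {I : finType}.
Variables (n : nat) (B : I -> {set I}).
Hypothesis n_gt1 : (1 < n)%N.
Let w i j := #|[set k | (i \in B k) && (j \in B k)]|.
Hypothesis w_diag : forall i, w i i = n.
Hypothesis w_offdiag : forall i j, i != j -> (w i j < n)%N.

Lemma sum_blocks (V : nmodType) (F : I -> V) :
  \sum_k \sum_(i in B k) F i = (\sum_i F i) *+ n.
Proof.
rewrite (exchange_big_dep predT) //= -sumrMnl; apply: eq_bigr => i _.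
by rewrite -(w_diag i) /w -sumr_const; apply: eq_bigl => k; rewrite inE andbb.
Qed.

(** On the left P_i P_j has weight [w i j]; on the right it has n on the diagonal and n - 1
    elsewhere. Pairs of weight exactly n - 1 cancel whatever the sign of their form; for smaller
    weights, commutation makes the form non-negative. *)
Lemma knabe_square (P : I -> 'M[C]_m) v :
  (forall i, (P i)^t* = P i) -> (forall i, P i *m P i = P i) ->
  (forall i j, i != j -> (w i j < n.-1)%N -> P i *m P j = P j *m P i) ->
  \sum_k qform ((\sum_(i in B k) P i) *m (\sum_(i in B k) P i)) v <=
  qform (\sum_i P i) v + n.-1%:R * qform ((\sum_i P i) *m (\sum_i P i)) v.
Proof.
move=> Ph Pi Pcomm.
under eq_bigr do rewrite qform_sum_mul.
(* Idempotence turns the linear term into diagonal terms P_i P_i, which raise the diagonal weight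
   from n - 1 to n. *)
rewrite [X in qform X v + _](eq_bigr (fun i => P i *m P i)); last by move=> i _.
rewrite qform_sum qform_sum_mul mulr_sumr -big_split exchange_big /=.
apply: ler_sum => i _; rewrite exchange_big /= mulr_sumr.
have sum_w j : \sum_k ((i \in B k) && (j \in B k))%:R = (w i j)%:R :> C.
  rewrite /w -sum1dep_card natr_sum [RHS]big_mkcond.
  by apply: eq_bigr => k _; case: (_ && _).
under eq_bigr do rewrite -mulr_suml sum_w.
rewrite (bigD1 i) //= [in leRHS](bigD1 i) //= addrA; apply: lerD.
  by rewrite w_diag mul1r -[X in X + _]mul1r -mulrDl -mulrS prednK // ltnW.
apply: ler_sum => j ji; rewrite mul1r.
have w_le : (w i j <= n.-1)%N by rewrite -ltnS (ltn_predK n_gt1) w_offdiag // eq_sym.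
have [w_lt|w_ge] := ltnP (w i j) n.-1; last first.
  by rewrite (@anti_leq (w i j) n.-1) ?w_le.
apply: ler_wpM2r; last by rewrite ler_nat.
by apply: qform_comm_proj_ge0 => //; apply: Pcomm; rewrite // eq_sym.
Qed.

(** An eigenvector of the self-adjoint [A] with nonzero eigenvalue is orthogonal to ker A, hence to
    the smaller space ker D. *)
Lemma gap_ge_transfer (A D : 'M[C]_m) (g l : C) (v : 'rV[C]_m) :
  psdmx A -> psdmx D -> gap_ge D g ->
  (forall u : 'rV_m, u *m D = 0 -> u *m A = 0) ->
  l != 0 -> v *m A = l *: v -> g * sqnorm v <= qform D v.
Proof.
move=> A_psd D_psd gap_g kerDA l_neq0 vA; apply: gap_ge_qform => // u uD.
apply: (scalerI l_neq0); rewrite scaler0 scalemxAl -vA -mulmxA.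
rewrite -[in A *m _]A_psd.1 -map_mxM -trmx_mul kerDA //.
by rewrite trmx0 map_mx0 mulmx0.
Qed.

(** The theorem for matrices: [H i], [HB k] and [Hp] stand for H_(X_i), H_(block k) and H^per on V,
    and [e] for the least block gap. *)
Lemma knabe_bound (H HB : I -> 'M[C]_m) (Hp : 'M[C]_m) (gamma c e : C) :
  (forall i, psdmx (H i)) -> (forall k, psdmx (HB k)) -> psdmx Hp ->
  (forall v, \sum_i qform (H i) v <= 2 * qform Hp v) ->
  (forall v, qform Hp v <= \sum_i qform (H i) v) ->
  (forall k v, qform (HB k) v <= \sum_(i in B k) qform (H i) v) ->
  (forall k i v, i \in B k -> qform (H i) v <= qform (HB k) v) ->
  (forall i j, i != j -> (w i j < n.-1)%N -> H i *m H j = H j *m H i) ->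
  0 <= gamma -> (forall i, gap_ge (H i) gamma) ->
  0 < c -> (forall i, eig_le (H i) c) ->
  (forall k, gap_ge (HB k) e) ->
  gap_ge Hp (gamma * (n%:R / (2 * c * (n%:R - 1)) * (e - c / n%:R))).
Proof.
move=> H_psd HB_psd Hp_psd sum_le2 le_sum block_le le_block H_comm.
move=> gamma_ge0 gap_gamma c_gt0 H_le_c gap_e.
pose P i := rangemx (H i); pose A k := \sum_(i in B k) P i.
have P_psd i : psdmx (P i) by apply: rangemx_psd.
have ge0 i v : 0 <= qform (H i) v := (H_psd i).2 v.
(* At an eigenvector of A_k: e |v|^2 <= <HB_k> <= sum of <H_i> <= c <A_k> = c l |v|^2. *)
have gap_A k : gap_ge (A k) (e / c).
  move=> l v l_gt0 v_neq0 vA; rewrite ler_pdivrMr //.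
  rewrite -(ler_pM2r (sqnorm_gt0 v_neq0)).
  have kerHB (u : 'rV_m) : u *m HB k = 0 -> u *m A k = 0.
    move=> uHB; have qHB : qform (HB k) u = 0 by rewrite /qform uHB mul0mx mxE.
    rewrite /A mulmx_sumr big1 // => i Bki; apply/(rangemx_ker (H_psd i)).
    apply: psdmx_ker => //; apply: le_anti; rewrite ge0 andbT -qHB.
    exact: le_block.
  apply: le_trans (_ : qform (HB k) v <= _).
    apply: gap_ge_transfer (psdmx_sum _ P_psd) (HB_psd k) (gap_e k) _ _ vA => //.
    by rewrite gt_eqF.
  apply: le_trans (block_le k v) _.
  rewrite mulrAC -(qform_eigen vA) mulrC qform_sum mulr_sumr.
  by apply: ler_sum => i _; apply: rangemx_eig_le; rewrite // ltW.
have n1_gt0 : 0 < n.-1%:R :> C by rewrite ltr0n -subn1 subn_gt0.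
have n1E : n.-1%:R = n%:R - 1 :> C by rewrite -subn1 natrB // ltnW.
(* Summing g A_k <= A_k^2 over k, with g = e / c, and applying [knabe_square] gives n g l <= l + (n
   - 1) l^2 for an eigenvalue l of the sum of the P_i; divide by l. *)
have gap_Ht : gap_ge (\sum_i P i) ((e / c * n%:R - 1) / n.-1%:R).
  move=> l v l_gt0 v_neq0 vP; rewrite ler_pdivrMr // lerBlDl.
  have lv_gt0 : 0 < l * sqnorm v by rewrite mulr_gt0 // sqnorm_gt0.
  rewrite -(ler_pM2r lv_gt0) -(qform_eigen vP).
  have P_comm i j : i != j -> (w i j < n.-1)%N -> P i *m P j = P j *m P i.
    move=> ij w_lt; apply: rangemx_comm => //; apply/esym/rangemx_comm => //.
    exact/esym/H_comm.
  have le_sq := knabe_square v (fun i => rangemx_herm (H i))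
    (fun i => rangemx_idem (H i)) P_comm.
  have -> : e / c * n%:R * qform (\sum_i P i) v =
            \sum_k e / c * qform (A k) v.
    rewrite -mulr_sumr; under [in RHS]eq_bigr do rewrite qform_sum.
    by rewrite sum_blocks -qform_sum -mulrA mulr_natl.
  apply: le_trans (_ : \sum_k qform (A k *m A k) v <= _).
    apply: ler_sum => k _; apply: gap_ge_qform_sq (gap_A k).
    exact: psdmx_sum.
  apply: le_trans le_sq _; rewrite (qform_sq_eigen vP) (qform_eigen vP).
  by rewrite le_eqVlt; apply/orP; left; apply/eqP; ring.
move=> l v l_gt0 v_neq0 vHp.
have v2_gt0 := sqnorm_gt0 v_neq0.
(* A vector killed by the sum of the P_i is killed by each P_i, hence by each H_i and, through
   [le_sum], by Hp. *)
have kerP (u : 'rV_m) : u *m (\sum_i P i) = 0 -> u *m Hp = 0.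
  move=> uP; apply: psdmx_ker => //; apply: le_anti; rewrite Hp_psd.2 andbT.
  apply: le_trans (le_sum u) _; rewrite big1 // => i _.
  have qP0 : \sum_i qform (P i) u = 0 by rewrite -qform_sum /qform uP mul0mx mxE.
  have /(rangemx_ker (H_psd i)) uH : u *m P i = 0.
    apply: psdmx_ker => //; move/eqP: qP0; rewrite psumr_eq0.
      by move=> /allP/(_ i); rewrite mem_index_enum => /(_ isT)/eqP.
    by move=> k _; apply: (P_psd k).2.
  by rewrite /qform uH // mul0mx mxE.
have := gap_ge_transfer Hp_psd (psdmx_sum xpredT P_psd) gap_Ht kerP _ vHp.
rewrite gt_eqF // => /(_ isT) /(ler_wpM2l gamma_ge0) le_qP.
(* The factor 2 of [sum_le2] becomes the 2 in the denominator of the final constant. *)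
have le_2l : gamma * qform (\sum_i P i) v <= 2 * (l * sqnorm v).
  rewrite -(qform_eigen vHp); apply: le_trans (sum_le2 v).
  by rewrite qform_sum mulr_sumr; apply: ler_sum => i _; apply: rangemx_gap.
have := le_trans le_qP le_2l; rewrite !mulrA ler_pM2r // => le_gamma.
rewrite -(ler_pM2l (ltr0Sn C 1)); apply: le_trans le_gamma.
rewrite le_eqVlt; apply/orP; left; apply/eqP; rewrite n1E.
rewrite n1E in n1_gt0; field.
by rewrite (gt_eqF n1_gt0) (gt_eqF c_gt0) pnatr_eq0 -lt0n ltnW.
Qed.
End Knabe.

(** * Cyclic arcs of indices *)

Definition cyc_arc N n (k : 'I_N) : {set 'I_N} :=
  [set iter m (@ordS N) k | m : 'I_n].

Lemma iter_ordS N (k : 'I_N.+1) m : iter m (@ordS N.+1) k = k + inZp m.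
Proof.
apply: val_inj => /=; rewrite modnDmr; elim: m => [|m IHm] /=.
  by rewrite addn0 modn_small.
by rewrite IHm -addn1 modnDml -addnA addn1.
Qed.

Lemma mem_arcP N n (k i : 'I_N.+1) :
  reflect (exists2 m, (m < n)%N & k = i - inZp m) (i \in cyc_arc n k).
Proof.
apply: (iffP imsetP) => [[m _ ->]|[m lt_mn ->]].
  by exists m => //; rewrite iter_ordS addrK.
by exists (Ordinal lt_mn); rewrite //= iter_ordS subrK.
Qed.

(** A form of membership suited to [lia]; the second disjunct is the part of the arc that has
    wrapped past the last index. *)
Lemma mem_arcE N n (k i : 'I_N.+1) : (n <= N.+1)%N ->
  (i \in cyc_arc n k) = (k <= i < k + n)%N || (i + N.+1 < k + n)%N.
Proof.
move=> n_le; have lt_k := ltn_ord k; have lt_i := ltn_ord i.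
apply/imsetP/idP => [[[m lt_m] _ ->]|].
  rewrite iter_ordS /= modnDmr.
  have [lt_km|le_km] := ltnP (k + m) N.+1; first by rewrite modn_small //; lia.
  rewrite -(subnK le_km) modnDr modn_small; lia.
move=> ki; pose m := if (k <= i)%N then (i - k)%N else (i + N.+1 - k)%N.
have lt_mn : (m < n)%N by rewrite /m; case: ifP => le_ki; lia.
exists (Ordinal lt_mn); rewrite // iter_ordS; apply: val_inj => /=.
rewrite modnDmr /m; case: leqP => le_ki; first by rewrite subnKC ?modn_small.
by rewrite subnKC ?modnDr ?modn_small //; lia.
Qed.

Lemma arc_id N n (k : 'I_N) : (0 < n)%N -> k \in cyc_arc n k.
Proof. by move=> n_gt0; apply/imsetP; exists (Ordinal n_gt0). Qed.

Lemma ordSE N (i : 'I_N.+1) : ordS i = (if i == N :> nat then 0 else i.+1) :> nat.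
Proof.
have := ltn_ord i; case: eqVneq => [/= ->|iN lt_i] /=; first by rewrite modnn.
by rewrite modn_small //; lia.
Qed.

Section Arc.
Variables (N n : nat).
Hypotheses (n_gt1 : (1 < n)%N) (n_le : (n <= N.+1 %/ 2)%N).
Implicit Types i j k : 'I_N.+1.

Let n_leN : (n <= N.+1)%N. Proof. by lia. Qed.

Let w i j := #|[set k | (i \in cyc_arc n k) && (j \in cyc_arc n k)]|.

(** The arcs through [i] are those starting at i, i - 1, ..., i - n + 1. *)
Lemma card_mem_arc i : w i i = n.
Proof.
rewrite -[RHS]card_ord -(@card_imset _ _ (fun m : 'I_n => i - inZp m)).
  apply: eq_card => k; rewrite inE andbb; apply/mem_arcP/imsetP.
    by case=> m lt_mn ->; exists (Ordinal lt_mn).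
  by case=> m _ ->; exists m.
move=> [a lt_a] [b lt_b] /addrI /oppr_inj /(congr1 val) /= ab.
by apply: val_inj => /=; move: ab; rewrite !modn_small //; lia.
Qed.

(** For distinct indices the cyclic distances from i to j and from j to i add up to N + 1, but here
    each is less than n, which is at most half of that. *)
Lemma arc_antisym i j : i \in cyc_arc n j -> j \in cyc_arc n i -> i = j.
Proof.
rewrite !mem_arcE // => ij ji; apply: val_inj => /=.
by have := ltn_ord i; have := ltn_ord j; lia.
Qed.

(** If the count were n, every arc through one index would contain the other; the arcs starting at i
    and at j would then contradict [arc_antisym]. *)
Lemma card_mem_arc2_lt i j : i != j -> (w i j < n)%N.
Proof.
move=> ij; have n_gt0 := ltnW n_gt1.
have w_sub k : w i j = n -> k \in [set i; j] ->
    (i \in cyc_arc n k) && (j \in cyc_arc n k).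
  move=> wE kij; have card_k : w k k = n := card_mem_arc k.
  have sub : [set l | (i \in cyc_arc n l) && (j \in cyc_arc n l)] \subset
             [set l | (k \in cyc_arc n l) && (k \in cyc_arc n l)].
    apply/fintype.subsetP => l; rewrite !inE andbb => /andP[il jl].
    by move: kij; rewrite !inE => /orP[] /eqP ->.
  have /eqP E : [set l | (i \in cyc_arc n l) && (j \in cyc_arc n l)] ==
             [set l | (k \in cyc_arc n l) && (k \in cyc_arc n l)].
    by rewrite eqEcard sub -/(w k k) -/(w i j) card_k wE leqnn.
  by have := arc_id k n_gt0; move/setP/(_ k): E; rewrite !inE andbb => -> ->.
have w_le : (w i j <= n)%N.
  rewrite -[leqRHS](card_mem_arc i); apply/subset_leq_card/fintype.subsetP => l.
  by rewrite !inE andbb => /andP[].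
rewrite ltn_neqAle w_le andbT; apply/eqP => wE.
have /andP[_ ji] := w_sub i wE (set21 _ _).
have /andP[ij' _] := w_sub j wE (set22 _ _).
by rewrite (arc_antisym ij' ji) eqxx in ij.
Qed.

(** Among the n arcs through [i], only the one ending at [i] misses its successor. *)
Lemma card_mem_arc2_next i : (n.-1 <= w i (ordS i))%N.
Proof.
pose K j := [set k | j \in cyc_arc n k].
have card_K : #|K i| = n.
  by rewrite -[RHS](card_mem_arc i); apply: eq_card => k; rewrite !inE andbb.
have le1 : (#|K i :\: K (ordS i)| <= 1)%N.
  apply/card_le1_eqP => k l; rewrite !inE !mem_arcE // ordSE => ki li.
  have := ltn_ord i; have := ltn_ord k; have := ltn_ord l => lt_l lt_k lt_i.
  by apply: val_inj => /=; move: ki li; case: eqVneq => ?; lia.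
have -> : w i (ordS i) = #|K i :&: K (ordS i)|.
  by apply: eq_card => k; rewrite !inE.
by have := cardsID (K (ordS i)) (K i); lia.
Qed.

(** An arc containing both neighbours of an index but not the index itself would run round the rest
    of the ring, which is too long for half its size. *)
Lemma arc_neighbours i k :
  ordS i \notin cyc_arc n k -> i \in cyc_arc n k -> ordS (ordS i) \notin cyc_arc n k.
Proof.
rewrite !mem_arcE // !ordSE; have := ltn_ord i; have := ltn_ord k.
by case: eqVneq => ?; case: eqVneq => ? //=; lia.
Qed.

End Arc.

(** * Local operators *)

Section Operators.
Context {R : realType} {S : finType} {d : S -> nat}.
Implicit Types (A B : 'End(hilb R d)) (phi psi : hilb R d) (s t u : config d).

Definition mix_config (X : {set S}) (u s : config d) : config d :=
  [ffun x => if x \in X then u x else s x].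

(** For disjoint supports a single intermediate configuration contributes, equal to [u] on X and to
    [s] elsewhere. The resulting kernel is symmetric in the two operators, whence [acts_on_comm]. *)
Lemma acts_on_comp (X Y : {set S}) A B a b :
  [disjoint X & Y] ->
  (forall psi s, A psi s =
     \sum_(t : config d | [forall x, (x \notin X) ==> (t x == s x)])
     a (restrict_config X s) (restrict_config X t) * psi t) ->
  (forall psi s, B psi s =
     \sum_(t : config d | [forall x, (x \notin Y) ==> (t x == s x)])
     b (restrict_config Y s) (restrict_config Y t) * psi t) ->
  forall psi s, A (B psi) s =
    \sum_(u : config d | [forall x, (x \notin X :|: Y) ==> (u x == s x)])
      a (restrict_config X s) (restrict_config X u) *
      b (restrict_config Y s) (restrict_config Y u) * psi u.
Proof.
move=> dXY AE BE psi s; rewrite AE.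
under eq_bigr do rewrite BE mulr_sumr.
rewrite (exchange_big_dep (fun u : config d =>
  [forall x, (x \notin X :|: Y) ==> (u x == s x)])) /=; last first.
  move=> t u /forallP ts /forallP ut; apply/forallP => x; apply/implyP.
  rewrite inE negb_or => /andP[xX xY].
  by have := ts x; have := ut x; rewrite xX xY /= => /eqP -> /eqP ->.
apply: eq_bigr => u /forallP us; rewrite (big_pred1 (mix_config X u s)) => [|t /=].
  rewrite mulrA; congr (a _ _ * b _ _ * _);
    apply/ffunP => -[x xXY]; rewrite !ffunE /= ?xXY //.
  by rewrite (disjointFl dXY xXY).
apply/andP/eqP => [[/forallP ts /forallP ut]|->].
  apply/ffunP => x; rewrite ffunE; have := ts x; have := ut x.
  have [xX /= |xX _ /eqP //] := boolP (x \in X).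
  by rewrite (disjointFr dXY xX) => /eqP ->.
split; apply/forallP => x; rewrite ffunE; apply/implyP => xY.
  by rewrite (negPf xY).
by have := us x; rewrite inE negb_or xY andbT; case: (x \in X).
Qed.

Lemma acts_on_comm (X Y : {set S}) A B : [disjoint X & Y] ->
  acts_on X A -> acts_on Y B -> forall psi, A (B psi) = B (A psi).
Proof.
move=> dXY [a AE] [b BE] psi; apply/ffunP => s.
rewrite (acts_on_comp dXY AE BE) (acts_on_comp _ BE AE) 1?disjoint_sym //.
rewrite finset.setUC; apply: eq_bigr => u _; congr (_ * _); exact: mulrC.
Qed.

(** There is only one configuration over no sites, so [A] is a scalar, and a nontrivial kernel
    forces that scalar to be 0. *)
Lemma acts_on_set0 A : acts_on finset.set0 A -> lker A != 0%VS -> A = 0.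
Proof.
case=> a AE kerA; have AE' psi s :
    A psi s = a (restrict_config finset.set0 s)
                (restrict_config finset.set0 s) * psi s.
  rewrite AE (big_pred1 s) // => t; apply/forallP/eqP => [ts|-> x]; last first.
    by rewrite eqxx implybT.
  by apply/ffunP => x; have := ts x; rewrite inE => /eqP.
have rE s t : restrict_config finset.set0 s = restrict_config finset.set0 t.
  by apply/ffunP => -[x x0]; exfalso; rewrite inE in x0.
have := vpick0 (lker A); rewrite (negPf kerA) => /negbT v_neq0.
have [s vs] : exists s, vpick (lker A) s != 0.
  apply/existsP; apply: contraNT v_neq0; rewrite negb_exists => /forallP v0.
  by apply/eqP/ffunP => s; rewrite ffunE; apply/eqP; have := v0 s; rewrite negbK.
have := memv_pick (lker A); rewrite memv_ker.
move=> /eqP /(congr1 (fun f : hilb R d => f s)).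
rewrite AE' ffunE => /eqP; rewrite mulf_eq0 (negPf vs) orbF => /eqP a0.
apply/lfunP => psi; apply/ffunP => t; rewrite AE' (rE t s) a0 mul0r lfunE.
by rewrite ffunE.
Qed.

Definition hform A psi : R[i] := inner psi (A psi).

Lemma inner_sumr (I : Type) (r : seq I) (D : pred I) (F : I -> hilb R d) phi :
  inner phi (\sum_(i <- r | D i) F i) = \sum_(i <- r | D i) inner phi (F i).
Proof.
rewrite /inner exchange_big /=; apply: eq_bigr => s _.
by rewrite sum_ffunE mulr_sumr.
Qed.

Lemma hform_sum (I : finType) (D : pred I) (F : I -> 'End(hilb R d)) psi :
  hform (\sum_(i | D i) F i) psi = \sum_(i | D i) hform (F i) psi.
Proof. by rewrite /hform sum_lfunE inner_sumr. Qed.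

Lemma inner_suml (I : Type) (r : seq I) (D : pred I) (F : I -> hilb R d) phi :
  inner (\sum_(i <- r | D i) F i) phi = \sum_(i <- r | D i) inner (F i) phi.
Proof.
rewrite /inner exchange_big /=; apply: eq_bigr => s _.
by rewrite sum_ffunE rmorph_sum mulr_suml.
Qed.

Lemma inner0r phi : inner phi 0 = 0.
Proof. by rewrite /inner big1 // => s _; rewrite ffunE mulr0. Qed.

Lemma self_adjoint_sum (I : finType) (D : pred I) (F : I -> 'End(hilb R d)) :
  (forall i, self_adjoint (F i)) -> self_adjoint (\sum_(i | D i) F i).
Proof.
move=> F_sa phi psi; rewrite !sum_lfunE inner_sumr inner_suml.
by apply: eq_bigr => i _; apply: F_sa.
Qed.

End Operators.

(** * Counting interaction terms on the ring *)

Section RingModel.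
Context {R : realType} {L : nat} {d : 'I_L -> nat} {N n : nat}.
Variables (M : spin_model R d) (X : 'I_N.+1 -> {set 'I_L}).
Hypotheses (n_gt1 : (1 < n)%N) (n_le : (n <= N.+1 %/ 2)%N).
Hypothesis X_meet : forall i j, i != j -> X i :&: X j != finset.set0 ->
  j = ordS i \/ i = ordS j.
Hypothesis X_terms : forall t : term M, exists i, supp t \subset X i.
Implicit Types (t : term M) (psi : hilb R d).

Lemma hform_term_ge0 t psi : 0 <= hform (interaction t) psi.
Proof. exact: term_psd. Qed.

(** An empty support lies in every X_i and would spoil the counts below; such a term contributes
    nothing. *)
Lemma term_supp0 t : supp t = finset.set0 -> interaction t = 0.
Proof.
by move=> t0; apply: acts_on_set0 (term_ker t); rewrite -t0; apply: term_acts_on.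
Qed.

(** Indices whose X_i share a point are cyclic neighbours, and a ring of at least four indices has
    no three mutual neighbours. *)
Lemma card_cover_le2 (Y : {set 'I_L}) : Y != finset.set0 ->
  (#|[set i | Y \subset X i]%SET| <= 2)%N.
Proof.
case/set0Pn => x xY; rewrite leqNgt; apply/card_gt2P => -[i [j [k [[]]]]].
rewrite !inE => iY jY kY [ij jk ki].
have adj a b : a != b -> Y \subset X a -> Y \subset X b -> b = ordS a \/ a = ordS b.
  move=> ab aY bY; apply: X_meet => //; apply/set0Pn; exists x.
  by rewrite inE (fintype.subsetP aY) ?(fintype.subsetP bY).
have val_adj (a b : 'I_N.+1) : b = ordS a \/ a = ordS b ->
    b = (if a == N :> nat then 0 else a.+1) :> nat \/
    a = (if b == N :> nat then 0 else b.+1) :> nat.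
  by move=> [->|->]; [left|right]; rewrite ordSE.
have := val_adj _ _ (adj _ _ ij iY jY); have := val_adj _ _ (adj _ _ jk jY kY).
have := val_adj _ _ (adj _ _ ki kY iY).
move: ij jk ki; rewrite -!val_eqE /= => ij jk ki.
by do 3![case: ifP => /eqP ?]; lia.
Qed.

(** If j is outside the block, each point of Y lies in some X_i with i in the block and next to j.
    By [arc_neighbours] the block cannot contain both neighbours of j, so one X_i serves for all of
    Y. *)
Lemma block_cover k (Y : {set 'I_L}) j :
  Y != finset.set0 -> Y \subset X j -> Y \subset block X n k ->
  exists2 i, i \in cyc_arc n k & Y \subset X i.
Proof.
move=> Y_neq0 Yj YB; have [jk|jk] := boolP (j \in cyc_arc n k); first by exists j.
have YBx x : x \in Y -> exists2 i, i \in cyc_arc n k & x \in X i.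
  move/(fintype.subsetP YB)/finset.bigcupP => [m _ xm].
  by exists (iter m (@ordS _) k) => //; apply/imsetP; exists m.
have adj x i : x \in Y -> i \in cyc_arc n k -> x \in X i -> j = ordS i \/ i = ordS j.
  move=> xY ik xi; apply: X_meet; first by apply: contraNneq jk => <-.
  by apply/set0Pn; exists x; rewrite inE xi (fintype.subsetP Yj).
case/set0Pn: Y_neq0 => x0 x0Y; have [i0 i0k x0i0] := YBx _ x0Y.
exists i0 => //; apply/fintype.subsetP => x xY; have [i ik xi] := YBx _ xY.
suff -> : i0 = i by [].
have ordSI : injective (@ordS N.+1) by apply: ordS_inj.
case: (adj _ _ x0Y i0k x0i0) (adj _ _ xY ik xi) => [ji0|i0j] [ji|ij].
- by apply: ordSI; rewrite -ji.
- have := @arc_neighbours N n n_gt1 n_le i0 k; rewrite -ji0 -ij ik i0k jk.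
  by move/(_ isT isT).
- have := @arc_neighbours N n n_gt1 n_le i k; rewrite -ji -i0j ik i0k jk.
  by move/(_ isT isT).
- by rewrite ij.
Qed.

Lemma sum_hform_le2 psi :
  \sum_i hform (ham M (X i)) psi <= 2 * hform (ham_per M) psi.
Proof.
rewrite hform_sum mulr_sumr; under eq_bigr do rewrite hform_sum.
rewrite (exchange_big_dep predT) //=; apply: ler_sum => t _.
rewrite sumr_const; have [t0|t_neq0] := eqVneq (supp t) finset.set0.
  by rewrite (term_supp0 t0) /hform lfunE /= inner0r mul0rn mulr0.
rewrite -[leLHS]mulr_natl; apply: ler_wpM2r; first exact: hform_term_ge0.
rewrite ler_nat; apply: leq_trans (card_cover_le2 t_neq0).
by rewrite cardsE.
Qed.

Lemma hform_le_sum psi :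
  hform (ham_per M) psi <= \sum_i hform (ham M (X i)) psi.
Proof.
rewrite hform_sum; under [leRHS]eq_bigr do rewrite hform_sum.
rewrite [leRHS](exchange_big_dep predT) //=; apply: ler_sum => t _.
have [i ti] := X_terms t; rewrite (bigD1 i) //= lerDl.
by apply: sumr_ge0 => j _; apply: hform_term_ge0.
Qed.

Lemma hform_block_le k psi :
  hform (ham M (block X n k)) psi <= \sum_(i in cyc_arc n k) hform (ham M (X i)) psi.
Proof.
rewrite hform_sum; under [leRHS]eq_bigr do rewrite hform_sum.
rewrite [leRHS](exchange_big_dep predT) //= big_mkcond; apply: ler_sum => t _.
case: ifP => [tB|_]; last by apply: sumr_ge0 => j _; apply: hform_term_ge0.
have [t0|t_neq0] := eqVneq (supp t) finset.set0.
  rewrite big1 ?(term_supp0 t0) // => *;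
    by rewrite ?(term_supp0 t0) /hform lfunE /= inner0r.
(* The index j given by [X_terms] may lie outside the block; [block_cover] replaces it by one
   inside. *)
have [j tj] := X_terms t; have [i ik ti] := block_cover t_neq0 tj tB.
rewrite (bigD1 i) ?ik //= lerDl.
by apply: sumr_ge0 => l _; apply: hform_term_ge0.
Qed.

Lemma hform_sub_block k i psi : i \in cyc_arc n k ->
  hform (ham M (X i)) psi <= hform (ham M (block X n k)) psi.
Proof.
case/imsetP => m _ ->; rewrite !hform_sum big_mkcond [leRHS]big_mkcond.
apply: ler_sum => t _; case: ifP => [tX|_]; last first.
  by case: ifP => // _; apply: hform_term_ge0.
by rewrite (fintype.subset_trans tX) //; apply: (finset.bigcup_sup m).
Qed.

(** By [X_meet] the two sets are disjoint, so their interaction terms commute pairwise. *)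
Lemma ham_comm i j psi : i != j -> j != ordS i -> i != ordS j ->
  ham M (X i) (ham M (X j) psi) = ham M (X j) (ham M (X i) psi).
Proof.
move=> ij /eqP jSi /eqP iSj; rewrite /ham !sum_lfunE.
rewrite (eq_bigr _ (fun t _ => raddf_sum _ _ _ _)) exchange_big /=.
rewrite [RHS](eq_bigr _ (fun t _ => raddf_sum _ _ _ _)) /=.
apply: eq_bigr => t tj; apply: eq_bigr => t' ti.
apply: acts_on_comm _ (term_acts_on t') (term_acts_on t) _.
have [Xij0|/X_meet [] //] := eqVneq (X i :&: X j) finset.set0.
rewrite -finset.setI_eq0 -finset.subset0 -Xij0; exact: finset.setISS.
Qed.

End RingModel.

(** * Coordinates on an invariant subspace *)

(** Gram-Schmidt on a basis of V, written as rows, yields an isometry from row vectors onto V. Since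
    [inner] is antilinear in its first argument, [c] and [c'] appear swapped on the right. *)
Lemma subspace_coords (R : realType) (S : finType) (d : S -> nat)
    (V : {vspace hilb R d}) :
  exists m (Phi : {linear 'rV[R[i]]_m -> hilb R d}),
    [/\ forall c, Phi c \in V,
        forall psi, psi \in V -> exists c, psi = Phi c &
        forall c c', inner (Phi c) (Phi c') = (c' *m c^t*) 0 0].
Proof.
pose K := #|config d|.
pose to_row (psi : hilb R d) : 'rV[R[i]]_K := \row_k psi (enum_val k).
pose of_row (r : 'rV[R[i]]_K) : hilb R d := [ffun s => r 0 (enum_rank s)].
pose W := \matrix_(i < \dim V) to_row (vbasis V)`_i.
pose E := schmidt (row_base W).
have E_unitary : E \is unitarymx by rewrite schmidt_unitarymx // rank_leq_col.
have EW : (E :=: W)%MS.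
  by apply: eqmx_trans (eqmx_schmidt_free (row_base_free W)) (eq_row_base W).
pose Phi (c : 'rV[R[i]]_(\rank W)) : hilb R d := of_row (c *m E).
have Phi_linear : linear Phi.
  move=> a c c'; apply/ffunP => s; rewrite /Phi mulmxDl -scalemxAl !ffunE.
  by rewrite !mxE.
pose Phi_lin : {linear 'rV[R[i]]_(\rank W) -> hilb R d} :=
  HB.pack Phi (GRing.isLinear.Build _ _ _ _ Phi Phi_linear).
exists (\rank W), Phi_lin; split.
- move=> c; change (of_row (c *m E) \in V).
  have /submxP[x ->] : (c *m E <= W)%MS by rewrite -EW submxMl.
  have -> : of_row (x *m W) = \sum_i x 0 i *: (vbasis V)`_i.
    apply/ffunP => s; rewrite sum_ffunE ffunE mxE; apply: eq_bigr => i _.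
    by rewrite !mxE ffunE enum_rankK.
  by apply: memv_suml => i _; rewrite memvZ // vbasis_mem // mem_nth // size_tuple.
- move=> psi psiV; have : (to_row psi <= E)%MS.
    rewrite EW; apply/submxP; exists (\row_i coord (vbasis V) i psi).
    apply/rowP => k; rewrite !mxE {1}(coord_vbasis psiV) sum_ffunE.
    by apply: eq_bigr => i _; rewrite ffunE !mxE.
  case/submxP => c psiE; exists c; apply/ffunP => s.
  by rewrite [RHS]ffunE -psiE mxE enum_rankK.
- move=> c c'; transitivity (((c' *m E) *m (c *m E)^t*) 0 0).
    rewrite /inner mxE (reindex (@enum_val (config d) predT)) /=; last first.
      by apply: onW_bij; apply: enum_val_bij.
    by apply: eq_bigr => k _; rewrite !ffunE enum_valK !mxE mulrC.
  by rewrite trmx_mul map_mxM mulmxA /= -[c' *m E *m _]mulmxA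
             (unitarymxP E_unitary) mulmx1.
Qed.

(** * Operators, gaps and norms on V in matrix form *)

Section Coordinates.
Context {R : realType} {S : finType} {d : S -> nat}.
Variables (V : {vspace hilb R d}) (m : nat).
Variable Phi : {linear 'rV[R[i]]_m -> hilb R d}.
Hypothesis Phi_V : forall c, Phi c \in V.
Hypothesis Phi_onto : forall psi, psi \in V -> exists c, psi = Phi c.
Hypothesis Phi_inner : forall c c', inner (Phi c) (Phi c') = (c' *m c^t*) 0 0.

Lemma coords_eq0 c : (Phi c == 0) = (c == 0).
Proof.
apply/eqP/eqP => [Pc0|->]; last exact: raddf0.
apply: contraTeq isT => /sqnorm_gt0; rewrite /sqnorm -Phi_inner Pc0.
by rewrite inner0r ltxx.
Qed.

Lemma coords_inj : injective Phi.
Proof.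
move=> c c' E; apply/eqP; rewrite -subr_eq0 -coords_eq0 raddfB /= E.
by rewrite subrr.
Qed.

Lemma coords_mx A : invariant_subspace A V ->
  exists M : 'M[R[i]]_m, forall c, A (Phi c) = Phi (c *m M).
Proof.
move=> AV; have /boolp.choice[f fE] (i : 'I_m) :
    exists c, A (Phi (delta_mx 0 i)) = Phi c.
  by apply: Phi_onto; apply: (subvP AV); rewrite memv_img.
exists (\matrix_i f i) => c; rewrite {1}(row_sum_delta c) !linear_sum.
rewrite mulmx_sum_row linear_sum; apply: eq_bigr => i _.
by rewrite !linearZ /= fE rowK.
Qed.

Variables (A : 'End(hilb R d)) (M : 'M[R[i]]_m).
Hypothesis AM : forall c, A (Phi c) = Phi (c *m M).

Lemma qform_coords c : qform M c = hform A (Phi c).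
Proof. by rewrite /hform AM Phi_inner. Qed.

Lemma coords_psdmx : self_adjoint A -> psd A -> psdmx M.
Proof.
move=> A_sa A_psd; split=> [|c]; last by rewrite qform_coords; apply: A_psd.
apply/matrixP => i j.
have := A_sa (Phi (delta_mx 0 j)) (Phi (delta_mx 0 i)).
rewrite !AM !Phi_inner trmx_mul map_mxM /= trmx_delta map_delta_mx.
by rewrite mulmxA -!rowE -!colE !mxE => ->.
Qed.

Lemma coords_eigen (c : 'rV_m) l : c *m M = l *: c <-> A (Phi c) = l *: Phi c.
Proof.
rewrite AM -linearZ; split=> [->//|]; exact: coords_inj.
Qed.

Lemma mem_leigenspace (B : 'End(hilb R d)) l psi :
  (psi \in passmx.leigenspace B l) = (B psi == l *: psi).
Proof.
by rewrite memv_ker add_lfunE opp_lfunE scale_lfunE id_lfunE subr_eq0.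
Qed.

(** Positive elements of [R[i]] are real, so the complex eigenvalues in [gap_ge] match the real ones
    in [gap]. *)
Lemma gap_coords (g : R) : gap_ge M g%:C%C <-> (g%:E <= gap A V)%E.
Proof.
split=> [gap_g|le_g l c l_gt0 c_neq0 cM].
  apply/ereal_infP => y [l [l_gt0]].
  rewrite -subv0 => /subvPn [psi]; rewrite memv_cap memv0.
  move=> /andP[psiV psi_l] psi_neq0 <-.
  have [c psiE] := Phi_onto psiV.
  rewrite lee_fin -lecR; apply: (gap_g _ c); rewrite ?ltcR //.
    by rewrite -coords_eq0 -psiE.
  apply/coords_eigen; rewrite -psiE; apply/eqP; move: psi_l.
  by rewrite mem_leigenspace.
have lE : l = (complex.Re l)%:C%C by rewrite RRe_real // gtr0_real.
rewrite lE lecR -lee_fin; apply: le_trans le_g _; apply: ereal_inf_lbound.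
exists (complex.Re l) => //; split; first by rewrite -ltcR -lE.
apply: contraNneq c_neq0 => VA0; rewrite -coords_eq0 -memv0 -VA0 memv_cap Phi_V.
rewrite mem_leigenspace -lE.
by apply/eqP/coords_eigen.
Qed.

Lemma hnorm_ge0 (psi : hilb R d) : 0 <= hnorm psi.
Proof. exact: sqrtr_ge0. Qed.

Lemma hnorm_coords c : ((hnorm (Phi c))%:C%C) ^+ 2 = sqnorm c.
Proof.
have c_ge0 := sqnorm_ge0 c; have [r cE] : exists r, sqnorm c = r%:C%C.
  by exists (complex.Re (sqnorm c)); rewrite RRe_real ?ger0_real.
rewrite /hnorm Phi_inner -/(sqnorm c) -rmorphXn cE /= sqr_sqrtr //.
by move: c_ge0; rewrite cE ler0c.
Qed.

Lemma hnorm_coords_gt0 c : c != 0 -> 0 < hnorm (Phi c).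
Proof.
move=> c_neq0; rewrite lt_neqAle hnorm_ge0 andbT eq_sym.
apply: contraTneq (sqnorm_gt0 c_neq0) => c0.
by rewrite -hnorm_coords c0 expr0n ltxx.
Qed.

Lemma opnorm_has_ubound : psdmx M ->
  has_ubound [set hnorm (A psi) / hnorm psi | psi in
    [set psi | psi \in V /\ psi != 0]]%classic.
Proof.
move=> M_psd; have [D D_ge0 le_D] := qform_sq_bound M_psd.
exists (complex.Re D) => _ [psi [psiV psi_neq0] <-].
have [c psiE] := Phi_onto psiV; rewrite psiE AM.
have c_neq0 : c != 0 by rewrite -coords_eq0 -psiE.
rewrite ler_pdivrMr ?hnorm_coords_gt0 // -lecR rmorphM /= RRe_real ?ger0_real //.
rewrite -(@ler_pXn2r _ 2) ?nnegrE ?mulr_ge0 ?ler0c ?hnorm_ge0 //.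
rewrite exprMn !hnorm_coords; apply: le_trans (le_D c).
by rewrite /qform /sqnorm trmx_mul map_mxM /= M_psd.1 !mulmxA.
Qed.

(** The quotient of norms in [opnorm] equals l at an eigenvector for l > 0. *)
Lemma eig_le_opnorm : psdmx M -> eig_le M (opnorm A V)%:C%C.
Proof.
move=> M_psd l c l_gt0 c_neq0 cM.
have lE : l = (complex.Re l)%:C%C by rewrite RRe_real // gtr0_real.
rewrite lE lecR; apply: (ub_le_sup (opnorm_has_ubound M_psd)).
exists (Phi c); first by rewrite /= coords_eq0.
apply/complexI; rewrite -lE rmorphM fmorphV /=; apply: (canLR (mulfK _)).
  by rewrite fmorph_eq0 gt_eqF // hnorm_coords_gt0.
apply/eqP; rewrite -(@eqrXn2 _ 2) ?mulr_ge0 ?ler0c ?hnorm_ge0 ?(ltW l_gt0) //.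
rewrite exprMn AM !hnorm_coords cM !sqnormE mulr_sumr; apply/eqP.
by apply: eq_bigr => i _; rewrite mxE normrM exprMn gtr0_norm.
Qed.

Lemma opnorm_mx0 : M = 0 -> opnorm A V <= 0.
Proof.
move=> M0; rewrite /opnorm; set E := (X in sup X).
(* The set of quotients is empty when V = 0, and its supremum is then 0. *)
have [->|/set0P E_neq0] := eqVneq E set0; first by rewrite sup0.
apply: ge_sup => // _ [psi [/Phi_onto[c ->] _] <-].
by rewrite AM M0 mulmx0 linear0 /hnorm inner0r sqrtr0 mul0r.
Qed.

Lemma gap_ge0 (B : 'End(hilb R d)) : (0 <= gap B V)%E.
Proof. by apply/ereal_infP => _ [l [l_gt0 _] <-]; rewrite lee_fin ltW. Qed.

(** A nonzero positive matrix has an eigenvalue l > 0; with an infinite gap, even l + 1 would be a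
    lower bound for l. *)
Lemma gap_mx_lt_pinfty : psdmx M -> M != 0 -> (gap A V < +oo)%E.
Proof.
move=> M_psd /(psdmx_eigen M_psd) [l [c [l_gt0 c_neq0 cM]]].
have lE : l = (complex.Re l)%:C%C by rewrite RRe_real // gtr0_real.
rewrite ltey; apply/eqP => gapE.
have : gap_ge M (complex.Re l + 1)%:C%C by apply/gap_coords; rewrite gapE leey.
move=> /(_ l c l_gt0 c_neq0 cM); rewrite {2}lE lecR.
by rewrite gerDl ler10.
Qed.

End Coordinates.

(** * Transfer of the matrix bound to the spin model *)

Theorem corollary2p2 (R : realType) (L : nat) (d : 'I_L -> nat)
    (M : spin_model R d) (V : {vspace hilb R d})
    (N n : nat) (X : 'I_N -> {set 'I_L})
    (M_ff : frustration_free M)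
    (V_inv : invariant_subspace (ham_per M) V)
    (V_ff : (V :&: lker (ham_per M))%VS != 0%VS)
    (X_interval : forall i, ring_interval (X i))
    (X_cover : (\bigcup_(i < N) X i)%SET = [set: 'I_L]%SET)
    (n_gt1 : (1 < n)%N) (n_le : (n <= N %/ 2)%N)
    (V_invX : forall i, invariant_subspace (ham M (X i)) V)
    (V_invB : forall k, invariant_subspace (ham M (block X n k)) V)
    (X_meet : forall i j : 'I_N, (i < j)%N -> (X i :&: X j)%SET != finset.set0 ->
       (j = i.+1 :> nat) \/ (j = N.-1 :> nat /\ i = 0%N :> nat))
    (X_terms : forall t : term M, exists i, supp t \subset X i) :
  let gamma : \bar R := ereal_inf (range (fun i => gap (ham M (X i)) V)) in
  let C : R := sup (range (fun i => opnorm (ham M (X i)) V)) in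
  0 < C ->
  (gamma * (n%:R / (2 * C * (n%:R - 1)))%:E *
     (\big[Order.min/+oo]_(k < N) gap (ham M (block X n k)) V
        - (C / n%:R)%:E)
   <= gap (ham_per M) V)%E.
Proof.
case: N X {X_interval X_cover} n_le V_invX V_invB X_meet X_terms => [|N] X.
  by rewrite leqn0 => /eqP n0; rewrite n0 in n_gt1.
move=> n_le V_invX V_invB X_meet X_terms gamma C C_gt0.
(* Condition (ii) in cyclic form: the exceptional pair of first and last index becomes i =
   [ordS j]. *)
have {}X_meet i j : i != j -> X i :&: X j != finset.set0 ->
    j = ordS i \/ i = ordS j.
  wlog lt_ij : i j / (i < j)%N => [hwlog ij meet|_ /(X_meet _ _ lt_ij)].
    have : (i != j :> nat) by rewrite val_eqE.
    case: (ltngtP i j) => // [lt_ij|lt_ji] _; first exact: hwlog.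
    rewrite eq_sym in ij; rewrite finset.setIC in meet.
    by apply/or_comm; apply: hwlog.
  have lt_j := ltn_ord j.
  case=> [ji|[jN i0]]; [left|right]; apply: ord_inj; rewrite ordSE.
    by rewrite ji ifN //; apply/eqP; lia.
  by rewrite i0 jN eqxx.
have [m [Phi [Phi_V Phi_onto Phi_inner]]] := subspace_coords V.
have /boolp.choice[H HE] i := coords_mx Phi_V Phi_onto (V_invX i).
have /boolp.choice[HB HBE] k := coords_mx Phi_V Phi_onto (V_invB k).
have [Hp HpE] := coords_mx Phi_V Phi_onto V_inv.
have ham_sa (D : pred (term M)) : self_adjoint (\sum_(t | D t) interaction t).
  by apply: self_adjoint_sum => t; apply: term_self_adjoint.
have ham_psd (D : pred (term M)) : psd (\sum_(t | D t) interaction t).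
  move=> psi; rewrite -[inner _ _]/(hform _ _) hform_sum sumr_ge0 // => t _.
  exact: hform_term_ge0.
have H_psd i : psdmx (H i).
  by apply: (@coords_psdmx _ _ _ _ _ Phi_inner _ _ (HE i));
    [apply: ham_sa|apply: ham_psd].
have HB_psd k : psdmx (HB k).
  by apply: (@coords_psdmx _ _ _ _ _ Phi_inner _ _ (HBE k));
    [apply: ham_sa|apply: ham_psd].
have Hp_psd : psdmx Hp.
  by apply: (@coords_psdmx _ _ _ _ _ Phi_inner _ _ HpE);
    [apply: ham_sa|apply: ham_psd].
have opnorm_le i : opnorm (ham M (X i)) V <= C.
  apply: ub_le_sup; last by exists i.
  exists (\sum_j `|opnorm (ham M (X j)) V|) => _ [j _ <-].
  rewrite (bigD1 j) //= (le_trans (ler_norm _)) // lerDl.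
  by apply: sumr_ge0 => l _.
(* C > 0 excludes that all [H i] vanish. A nonzero [H i0] makes gamma finite and, as the block
   starting at i0 contains X_i0, also the least block gap; the extended real bound thus becomes a
   real one. *)
have [i0 Hi0] : exists i, H i != 0.
  apply/existsP; apply: contraTT C_gt0; rewrite negb_exists => /forallP H0.
  rewrite -leNgt; apply: ge_sup => [|_ [i _ <-]].
    by exists (opnorm (ham M (X ord0)) V), ord0.
  apply: (opnorm_mx0 Phi_onto (HE i)); apply/eqP.
  by have := H0 i; rewrite negbK.
have qH i c : qform (H i) c = hform (ham M (X i)) (Phi c).
  by rewrite (qform_coords Phi_inner (HE i)).
have qHB k c : qform (HB k) c = hform (ham M (block X n k)) (Phi c).
  by rewrite (qform_coords Phi_inner (HBE k)).
have qHp c : qform Hp c = hform (ham_per M) (Phi c).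
  by rewrite (qform_coords Phi_inner HpE).
have le_block k i c : i \in cyc_arc n k -> qform (H i) c <= qform (HB k) c.
  by move=> ik; rewrite qH qHB; apply: hform_sub_block.
have HBi0 : HB i0 != 0.
  apply: contraNneq Hi0 => HB0; apply/eqP/row_matrixP => i; rewrite row0 rowE.
  apply: (psdmx_ker (H_psd i0)); apply: le_anti; rewrite (H_psd i0).2 andbT.
  apply: le_trans (le_block i0 i0 _ (arc_id _ (ltnW n_gt1))) _.
  by rewrite HB0 /qform mulmx0 mul0mx mxE.
have gamma_le i : (gamma <= gap (ham M (X i)) V)%E.
  by apply: ereal_inf_lbound; exists i.
have [r r_ge0 gammaE] : exists2 r, 0 <= r & gamma = r%:E.
  have gamma_ge0 : (0 <= gamma)%E by apply/ereal_infP => _ [i _ <-]; apply: gap_ge0.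
  have gamma_fin : (gamma < +oo)%E.
    apply: le_lt_trans (gamma_le i0) _.
    exact (gap_mx_lt_pinfty Phi_V Phi_onto Phi_inner (HE i0) (H_psd i0) Hi0).
  by case: gamma gamma_ge0 gamma_fin {gamma_le} => // r; rewrite lee_fin; exists r.
set mn := \big[_/_]_(k < _) _.
have mn_le k : (mn <= gap (ham M (block X n k)) V)%E by apply: bigmin_le.
have [e mnE] : exists e, mn = e%:E.
  have mn_ge0 : (0 <= mn)%E by apply/bigmin_geP; split=> [|k _]; rewrite ?leey ?gap_ge0.
  have mn_fin : (mn < +oo)%E.
    apply: le_lt_trans (mn_le i0) _.
    exact (gap_mx_lt_pinfty Phi_V Phi_onto Phi_inner (HBE i0) (HB_psd i0) HBi0).
  by case: mn mn_ge0 mn_fin {mn_le} => // e; exists e.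
rewrite gammaE mnE -EFinB -!EFinM -mulrA.
apply/(gap_coords Phi_V Phi_onto Phi_inner HpE).
rewrite !(rmorphM, rmorphB, fmorphV, rmorph1, rmorph_nat) /=.
apply: (@knabe_bound _ _ _ n (cyc_arc n) n_gt1 _ _ H HB) => //.
- exact: card_mem_arc.
- by move=> i j ij; apply: card_mem_arc2_lt.
- move=> c; rewrite qHp; under eq_bigr do rewrite qH.
  exact (sum_hform_le2 M n_gt1 n_le X_meet (Phi c)).
- by move=> c; rewrite qHp; under eq_bigr do rewrite qH; apply: hform_le_sum.
- move=> k c; rewrite qHB; under eq_bigr do rewrite qH.
  exact (hform_block_le n_gt1 n_le X_meet X_terms k (Phi c)).
(* Neighbouring indices share at least n - 1 blocks, so [lt_w] leaves only pairs to which [ham_comm]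
   applies. *)
- move=> i j ij lt_w.
  have jSi : j != ordS i.
    by apply: contraTneq lt_w => ->; rewrite -leqNgt card_mem_arc2_next.
  have iSj : i != ordS j.
    apply: contraTneq lt_w => ->; rewrite -leqNgt.
    apply: leq_trans (card_mem_arc2_next n_gt1 n_le j) _.
    by apply/subset_leq_card/fintype.subsetP => k; rewrite !inE andbC.
  apply/row_matrixP => l; rewrite !rowE.
  apply: (coords_inj Phi_inner); rewrite !mulmxA -!HE.
  by rewrite (ham_comm M X_meet _ ij jSi iSj).
- by rewrite ler0c.
- move=> i; apply/(gap_coords Phi_V Phi_onto Phi_inner (HE i)).
  by rewrite -gammaE.
- by rewrite ltcR.
- move=> i l c l_gt0 c_neq0 cH.
  apply: le_trans
    (eig_le_opnorm Phi_V Phi_onto Phi_inner (HE i) (H_psd i) l_gt0 c_neq0 cH) _.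
  by rewrite lecR.
- move=> k; apply/(gap_coords Phi_V Phi_onto Phi_inner (HBE k)).
  by rewrite -mnE.
Qed.
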